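(* Consider the system $x_{k+1}=f(x_k,u_k)$ controlled by iSCD-MPC with the stopping rule that defines $\rho_k$. Assume: (A1) $A:\mathbb R^n\times\mathbb R^m\to\mathbb R^{n\times n}$ and $B:\mathbb R^n\times\mathbb R^m\to\mathbb R^{n\times m}$ are continuously differentiable and there exist $L_A,L_B\in(0,\infty)$ such that for all $x,\hat x\in\mathbb R^n$, $u,\hat u\in\mathbb R^m$, $\|A(x,u)-A(\hat x,\hat u)\|\le L_A(\|x-\hat x\|+\|u-\hat u\|)$ and $\|B(x,u)-B(\hat x,\hat u)\|\le L_B(\|x-\hat x\|+\|u-\hat u\|)$; (A2) there exist $\bar a,\bar b\in(0,\infty)$ such that $\sup_{x,u}\|A(x,u)\|\le\bar a$ and $\sup_{x,u}\|B(x,u)\|\le\bar b$. Let $\delta_U\in(0,\infty)$ and $\mathcal B=\{U\in\mathbb R^{m(\ell-1)}:\|U\|\le\delta_U\}$. Let $k\in\mathbb N$, and assume that there exist $\gamma\in(0,1)$, $c_0\in[1,\infty)$, and $c_{\mathcal M}\in(0,\infty)$ such that $\|x_{k,1}\|\le\min\{\delta_U/c_0,\ \gamma/c_{\mathcal M}\}$. Assume further that $U_{k|1}\in\mathcal B$ and $U_{k|2}\ne U_{k|1}$. Then the termination iteration $\rho_k$ satisfies $$\rho_k\le\min\left\{\rho,\ 2+\max\left\{0,\ \left\lfloor\frac{\ln\big(\varepsilon/\|U_{k|2}-U_{k|1}\|\big)}{\ln\gamma}\right\rfloor+1\right\}\right\}.$$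
   Context: $\mathbb N=\{0,1,2,\ldots\}$; $\|\cdot\|$ is the Euclidean norm on vectors and the induced norm on matrices. System: $x_{k+1}=f(x_k,u_k)$ with $x_k\in\mathbb R^n$, $u_k\in\mathbb R^m$, where $f(x,u)=A(x,u)x+B(x,u)u$ for all $(x,u)$. For each $k\in\mathbb N$, the anchor is $x_{k,1}=f(x_k,u_k)$. The horizon is an integer $\ell\ge2$. Weights: $Q\in\mathbb R^{n\times n}$ symmetric positive semidefinite, $R\in\mathbb R^{m\times m}$ symmetric positive definite, and $P\in\mathbb R^{n\times n}$ symmetric positive definite, the stabilizing solution of the discrete algebraic Riccati equation $P=A_0^TPA_0-A_0^TPB_0(2R+B_0^TPB_0)^{-1}B_0^TPA_0+2Q$, where $A_0=A(0,0)$, $B_0=B(0,0)$. Let $\mathcal Q=\mathrm{diag}(Q,\ldots,Q,P)\in\mathbb R^{n\ell\times n\ell}$ ($\ell-1$ copies of $Q$) and $\mathcal R=\mathrm{diag}(R,\ldots,R)\in\mathbb R^{m(\ell-1)\times m(\ell-1)}$. Iteration map: for $\xi\in\mathbb R^n$ and $U=(u_1,\ldots,u_{\ell-1})\in\mathbb R^{m(\ell-1)}$ (stacked), define the rollout $x_1(\xi,U)=\xi$, $x_{j+1}(\xi,U)=f(x_j(\xi,U),u_j)$ for $j\in\{1,\ldots,\ell-1\}$, and put $A_j=A(x_j(\xi,U),u_j)$, $B_j=B(x_j(\xi,U),u_j)$. Let $\Phi(\xi,U)\in\mathbb R^{n\ell\times n}$ be the block column with first block $I_n$ and $r$th block $A_{r-1}\cdots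 A_1$ for $r\in\{2,\ldots,\ell\}$. Let $\Gamma(\xi,U)\in\mathbb R^{n\ell\times m(\ell-1)}$ have $(r,c)$ block, for $r\in\{2,\ldots,\ell\}$ and $c\in\{1,\ldots,r-1\}$, equal to $B_{r-1}$ if $c=r-1$ and $A_{r-1}\cdots A_{c+1}B_c$ if $c<r-1$, all other blocks being zero. Let $\mathcal H(\xi,U)=\mathcal R+\Gamma(\xi,U)^T\mathcal Q\,\Gamma(\xi,U)$, and $$\mathcal M(\xi,U)=-\mathcal H(\xi,U)^{-1}\Gamma(\xi,U)^T\mathcal Q\,\Phi(\xi,U)\,\xi .$$ iSCD-MPC: at each step $k$, starting from a control sequence $U_{k|1}$, the iterates $U_{k|i}$, $i\ge2$, solve the linear-quadratic program whose coefficients are frozen along the rollout from $x_{k,1}$ under $U_{k|i-1}$; the state and control constraints are taken to be inactive, so that $U_{k|i}=\mathcal M(x_{k,1},U_{k|i-1})$. Stopping rule: $\rho\in\{1,2,\ldots\}$ is the maximum number of iterations, $\varepsilon\in(0,\infty)$ is the tolerance, and $$\rho_k=\min\big\{\rho,\ \min\{i\in\{2,\ldots,\rho\}:\ \|U_{k|i}-U_{k|i-1}\|<\varepsilon\}\big\},$$ where the inner minimum is defined to be $\rho$ if the tolerance is not met for any $i\in\{2,\ldots,\rho\}$. The applied control $u_{k+1}$ is the first block of $U_{k|\rho_k}$.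
   Formalization: The constants c_0 and c_M are not arbitrary, for which the bound is false; the result proved is that there exist c_0 ≥ 1 and c_M > 0, depending only on the system, weights, horizon and δ_U, such that the bound holds for every γ, ρ, ε, run and k meeting the other assumptions. *)

(* Defs.v *)
From HB Require Import structures.
From mathcomp Require Import all_boot all_order all_algebra.
From mathcomp Require Import all_classical all_reals all_analysis.
From mathcomp Require Import complex.

Set Implicit Arguments.
Unset Strict Implicit.
Unset Printing Implicit Defensive.

Import Order.TTheory GRing.Theory Num.Theory.
Import numFieldNormedType.Exports.

Local Open Scope classical_set_scope.
Local Open Scope ring_scope.

Section Norms.
Variable R : realType.

(* The library's norm on matrices is the max norm, hence these two. *)
Definition enorm (n : nat) (v : 'cV[R]_n) : R :=
  Num.sqrt (\sum_(i < n) v i 0 ^+ 2).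

Definition opnorm (p q : nat) (M : 'M[R]_(p, q)) : R :=
  sup [set enorm (M *m v) | v in [set v : 'cV[R]_q | enorm v <= 1]].

End Norms.

(* The second conjunct is the continuity of the Frechet derivative for the
   operator norm; since the spaces below are finite dimensional, the choice of
   the norms is immaterial. *)
Definition continuously_differentiable (R : realType) (V W : normedModType R)
    (g : V -> W) : Prop :=
  (forall p, differentiable g p) /\
  (forall p (e : R), 0 < e ->
     \forall q \near p, forall v, `|'d g q v - 'd g p v| <= e * `|v|).

Section Weights.
Variable R : realType.

Definition sym_psd (n : nat) (M : 'M[R]_n) : Prop :=
  M^T = M /\ forall v : 'cV[R]_n, 0 <= (v^T *m M *m v) 0 0.

Definition sym_pd (n : nat) (M : 'M[R]_n) : Prop :=
  M^T = M /\ forall v : 'cV[R]_n, v != 0 -> 0 < (v^T *m M *m v) 0 0.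

Definition schur_stable (n : nat) (M : 'M[R]_n) : Prop :=
  forall z : R[i], eigenvalue (map_mx (real_complex R) M) z -> `|z| < 1.

(* P solves the discrete algebraic Riccati equation with state weight 2 Q and
   control weight 2 Rw, and A0 - B0 K is Schur stable for the associated
   gain K. *)
Definition stabilizing_dare_solution (n m : nat)
    (A0 : 'M[R]_n) (B0 : 'M[R]_(n, m)) (Q : 'M[R]_n) (Rw : 'M[R]_m)
    (P : 'M[R]_n) : Prop :=
  let S := 2%:R *: Rw + B0^T *m P *m B0 in
  P = A0^T *m P *m A0
      - A0^T *m P *m B0 *m invmx S *m B0^T *m P *m A0 + 2%:R *: Q /\
  schur_stable (A0 - B0 *m (invmx S *m B0^T *m P *m A0)).

End Weights.

Section IterationMap.
Variables (R : realType) (n m : nat).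
Variables (A : 'cV[R]_n -> 'cV[R]_m -> 'M[R]_n).
Variables (B : 'cV[R]_n -> 'cV[R]_m -> 'M[R]_(n, m)).

Definition dyn (x : 'cV[R]_n) (u : 'cV[R]_m) : 'cV[R]_n :=
  A x u *m x + B x u *m u.

Variables (Q : 'M[R]_n) (Rw : 'M[R]_m) (P : 'M[R]_n) (ell : nat).

(* Stacked control sequences: ell - 1 blocks of size m.  Blocks, rollout states
   and frozen coefficients are indexed from 0 instead of 1. *)
Definition ctrl_seq : Type := 'cV[R]_(\sum_(j < ell.-1) m).

(* The default value 0 is only for j outside the range [0, ell - 1). *)
Definition ctrl_block (U : ctrl_seq) (j : nat) : 'cV[R]_m :=
  oapp (fun i : 'I_ell.-1 => @submxcol R ell.-1 (fun=> m) 1 U i) 0 (insub j).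

Fixpoint rollout (xi : 'cV[R]_n) (U : ctrl_seq) (j : nat) : 'cV[R]_n :=
  if j is j'.+1 then dyn (rollout xi U j') (ctrl_block U j') else xi.

Definition frozenA xi U (j : nat) : 'M[R]_n :=
  A (rollout xi U j) (ctrl_block U j).

Definition frozenB xi U (j : nat) : 'M[R]_(n, m) :=
  B (rollout xi U j) (ctrl_block U j).

(* transition xi U c d = A_(c+d-1) ... A_(c+1) A_c  (d factors) *)
Fixpoint transition xi U (c d : nat) : 'M[R]_n :=
  if d is d'.+1 then frozenA xi U (c + d') *m transition xi U c d' else 1%:M.

Definition bigPhi xi U : 'M[R]_(\sum_(r < ell) n, n) :=
  \mxcol_(r < ell) transition xi U 0 r.

Definition bigGamma xi U : 'M[R]_(\sum_(r < ell) n, \sum_(c < ell.-1) m) :=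
  \mxblock_(r < ell, c < ell.-1)
    (if (c < r)%N then transition xi U c.+1 (r - c.+1) *m frozenB xi U c
     else 0).

Definition bigQ : 'M[R]_(\sum_(r < ell) n) :=
  \mxdiag_(r < ell) (if r == ell.-1 :> nat then P else Q).

Definition bigR : 'M[R]_(\sum_(c < ell.-1) m) := \mxdiag_(c < ell.-1) Rw.

Definition bigH xi U : 'M[R]_(\sum_(c < ell.-1) m) :=
  bigR + (bigGamma xi U)^T *m bigQ *m bigGamma xi U.

Definition iter_map (xi : 'cV[R]_n) (U : ctrl_seq) : ctrl_seq :=
  - (invmx (bigH xi U) *m (bigGamma xi U)^T *m bigQ *m bigPhi xi U *m xi).

(* Us i is the i-th iterate, i >= 1 (Us 0 is never used).  As every index in
   the range is at most rho, the inner minimum equals rho when the tolerance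
   is never met. *)
Definition term_iter (rho : nat) (eps : R) (Us : nat -> ctrl_seq) : nat :=
  minn rho (\big[minn/rho]_(2 <= i < rho.+1 |
                             enorm (Us i - Us i.-1) < eps) i).

(* Closed-loop run: states x k, controls u k, iterates U k i (i >= 1), where
   the initial data and the starting sequences U k 1 are arbitrary. *)
Definition iSCD_MPC_run (rho : nat) (eps : R) (x : nat -> 'cV[R]_n)
    (u : nat -> 'cV[R]_m) (U : nat -> nat -> ctrl_seq) : Prop :=
  [/\ forall k, x k.+1 = dyn (x k) (u k),
      forall k i, (2 <= i)%N ->
        U k i = iter_map (dyn (x k) (u k)) (U k i.-1)
    & forall k, u k.+1 = ctrl_block (U k (term_iter rho eps (U k))) 0].

End IterationMap.

(* Main.v *)
Require Import Defs.
From HB Require Import structures.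
From mathcomp Require Import all_boot all_order all_algebra.
From mathcomp Require Import all_classical all_reals all_analysis.
From mathcomp Require Import ring.
Import Order.TTheory GRing.Theory Num.Theory.
Import numFieldNormedType.Exports.
Local Open Scope classical_set_scope.
Local Open Scope ring_scope.

(** The iteration map has the form U |-> - K(xi, U) xi, where the gain K is built
    from the coefficients A and B along the rollout by sums, products and one
    matrix inversion. On the ball of radius deltaU the gain is bounded and
    Lipschitz in U, uniformly in the anchor xi: sums and products preserve this
    property, composition with A and B preserves it because these are bounded
    and Lipschitz, and inversion of the Hessian preserves it because the Hessian
    is bounded below by the fixed positive definite control weight
    ([invmx_entry_sq_le], [bounded_lip_invmx]).

    Hence there is a constant C with |M(xi, U)| <= C |xi| and
    |M(xi, U) - M(xi, V)| <= C |xi| |U - V| on the ball ([iter_map_bounds]). With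
    c0 = cM = 1 + C, the bound |xi| <= deltaU / c0 keeps all iterates in the ball
    and |xi| <= gamma / cM makes the map a gamma-contraction there, so that the
    increments decay like gamma^i ([run_increments]). The tolerance is then met
    once gamma^i times the first increment is below eps, and solving this for i
    gives the stated bound ([term_iter_le]). *)

(** * Quadratic forms and bounds on inverses *)

Section QuadraticForms.
Context {R : realType}.

Definition bilin {n} (S : 'M[R]_n) (u v : 'cV[R]_n) : R := (u^T *m S *m v) 0 0.

Lemma bilinDl {n} (S : 'M[R]_n) a b u v w :
  bilin S (a *: u + b *: v) w = a * bilin S u w + b * bilin S v w.
Proof. by rewrite /bilin linearD/= !linearZ/= !mulmxDl -!scalemxAl !mxE. Qed.

Lemma bilinDr {n} (S : 'M[R]_n) a b u v w :
  bilin S w (a *: u + b *: v) = a * bilin S w u + b * bilin S w v.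
Proof. by rewrite /bilin mulmxDr -!scalemxAr !mxE. Qed.

Lemma bilin_sym {n} (S : 'M[R]_n) u v : S^T = S -> bilin S u v = bilin S v u.
Proof.
move=> hS; rewrite /bilin -[u^T *m S *m v]trmxK [in LHS]mxE.
by rewrite !trmx_mul trmxK hS mulmxA.
Qed.

Lemma bilin_addmx {n} (S S' : 'M[R]_n) u v :
  bilin (S + S') u v = bilin S u v + bilin S' u v.
Proof. by rewrite /bilin mulmxDr mulmxDl mxE. Qed.

Lemma bilin_congr {n p} (G : 'M[R]_(n, p)) (S : 'M[R]_n) u v :
  bilin (G^T *m S *m G) u v = bilin S (G *m u) (G *m v).
Proof. by rewrite /bilin trmx_mul !mulmxA. Qed.

Lemma bilin_mxdiag {k} {p : 'I_k -> nat} (S : forall i, 'M[R]_(p i))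
    (u v : 'cV[R]_(\sum_i p i)) :
  bilin (\mxdiag_i S i) u v = \sum_i bilin (S i) (submxcol u i) (submxcol v i).
Proof.
rewrite /bilin -[in LHS](submxcolK u) -[in LHS](submxcolK v) tr_mxcol.
rewrite mul_mxrow_mxdiag mul_mxrow_mxcol summxE.
by apply: eq_bigr => i _.
Qed.

Lemma sym_pd_psd {n} (S : 'M[R]_n) : sym_pd S -> sym_psd S.
Proof.
case=> symS pS; split=> // v; have [->|/pS/ltW//] := eqVneq v 0.
by rewrite mulmx0 mxE.
Qed.

Lemma sym_psd_mxdiag {k} {p : 'I_k -> nat} (S : forall i, 'M[R]_(p i)) :
  (forall i, sym_psd (S i)) -> sym_psd (\mxdiag_i S i).
Proof.
move=> hS; split=> [|v].
  by rewrite tr_mxdiag; apply: eq_mxdiag => i; case: (hS i).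
rewrite -/(bilin _ v v) bilin_mxdiag; apply: sumr_ge0 => i _.
by case: (hS i) => _; apply.
Qed.

Lemma sym_pd_mxdiag {k} {p : 'I_k -> nat} (S : forall i, 'M[R]_(p i)) :
  (forall i, sym_pd (S i)) -> sym_pd (\mxdiag_i S i).
Proof.
move=> hS; have [symS pS] : sym_psd (\mxdiag_i S i).
  by apply: sym_psd_mxdiag => i; apply: sym_pd_psd.
split=> // v v0; rewrite lt_def pS andbT; apply: contra v0 => /eqP.
rewrite -/(bilin _ v v) bilin_mxdiag => /psumr_eq0P h0.
apply/eqP/mxcolP => i; have [_ /(_ (submxcol v i)) pi] := hS i.
have -> : submxcol (0 : 'cV[R]_(\sum_i p i)) i = 0.
  by apply/matrixP => a b; rewrite !mxE.
apply/eqP; apply: contraT => /pi; rewrite -/(bilin _ _ _) h0 ?ltxx// => j _.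
by case: (sym_pd_psd _ (hS j)) => _; apply.
Qed.

(** Nonnegativity of the form of S at
    [bilin S v v *: u - bilin S u v *: v]. *)
Lemma bilin_CauchySchwarz {n} (S : 'M[R]_n) u v :
  sym_pd S -> bilin S u v ^+ 2 <= bilin S u u * bilin S v v.
Proof.
move=> hS; have [_ pS] := sym_pd_psd _ hS.
have [v0|v0] := eqVneq v 0.
  by rewrite /bilin v0 !mulmx0 mxE mulr0 expr0n.
have a_gt0 : 0 < bilin S v v by case: hS => _; apply.
rewrite -subr_ge0 -(pmulr_rge0 _ a_gt0).
have := pS (bilin S v v *: u + (- bilin S u v) *: v).
rewrite -/(bilin _ _ _) bilinDl !bilinDr (bilin_sym _ v u (proj1 hS)).
by congr (_ <= _); ring.
Qed.

Lemma bilin_unitmx {n} (S : 'M[R]_n) :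
  (forall v, v != 0 -> 0 < bilin S v v) -> S \in unitmx.
Proof.
move=> pS; rewrite -row_free_unit; apply/inj_row_free => v vS.
apply/trmx_inj; rewrite trmx0; apply/eqP; apply: contraT => /pS.
by rewrite /bilin trmxK vS mul0mx mxE ltxx.
Qed.

(** A lower bound S <= H, with S fixed, bounds the inverse of H by data of S
    alone. With y the j-th column of the inverse of H and r_k the k-th column of
    the inverse of S, one has S(y, y) <= H(y, y) = y_j and S(y, r_k) = y_k, so
    Cauchy-Schwarz for S gives y_k^2 <= S(r_k, r_k) S(y, y), where
    S(r_k, r_k) is the k-th diagonal entry of the inverse of S. The case k = j
    bounds y_j, hence S(y, y), and the case k = i concludes. *)
Lemma invmx_entry_sq_le {n} (S H : 'M[R]_n) i j : sym_pd S ->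
  (forall v, bilin S v v <= bilin H v v) ->
  invmx H i j ^+ 2 <= invmx S i i * invmx S j j.
Proof.
move=> hS SH; have [symS pS] := hS; have [_ psS] := sym_pd_psd _ hS.
have uS : S \in unitmx by apply: bilin_unitmx.
have uH : H \in unitmx.
  by apply: bilin_unitmx => v /pS/lt_le_trans; apply; apply: SH.
pose y := col j (invmx H).
have Hy w : bilin H w y = w j 0.
  by rewrite /bilin /y -mulmxA colE (mulKVmx uH) -colE !mxE.
pose r k : 'cV[R]_n := col k (invmx S).
have ry k w : bilin S w (r k) = w k 0.
  by rewrite /bilin /r -mulmxA colE (mulKVmx uS) -colE !mxE.
(* The entry y_k is S(y, r_k): this is Cauchy-Schwarz. *)
have yE k : y k 0 ^+ 2 <= invmx S k k * bilin S y y.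
  rewrite -ry mulrC; apply: le_trans (bilin_CauchySchwarz _ _ _ hS) _.
  by rewrite ry [r k k 0]mxE.
have rk k : 0 <= invmx S k k.
  by have := psS (r k); rewrite -/(bilin _ _ _) ry [r k k 0]mxE.
have syy : bilin S y y <= y j 0 by rewrite -Hy; apply: SH.
have yj0 : 0 <= y j 0 by apply: le_trans syy; apply: psS.
have yjle : y j 0 <= invmx S j j.
  have [->//|yjn0] := eqVneq (y j 0) 0.
  have yjp : 0 < y j 0 by rewrite lt_def yjn0.
  rewrite -(ler_pM2r yjp) -expr2; apply: le_trans (yE j) _.
  by rewrite ler_wpM2l.
have -> : invmx H i j = y i 0 by rewrite mxE.
apply: le_trans (yE i) _; rewrite ler_wpM2l//.
exact: le_trans yjle.
Qed.

End QuadraticForms.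

(** * Euclidean norm *)

Section EuclideanNorm.
Context {R : realType}.

Lemma enorm_ge0 {n} (v : 'cV[R]_n) : 0 <= enorm v.
Proof. exact: sqrtr_ge0. Qed.

Lemma entry_le_enorm {n} (v : 'cV[R]_n) i : `|v i 0| <= enorm v.
Proof.
rewrite -sqrtr_sqr ler_wsqrtr// (bigD1 i)//= lerDl.
by apply: sumr_ge0 => j _; exact: sqr_ge0.
Qed.

Lemma enorm_le_sum {n} (v : 'cV[R]_n) : enorm v <= \sum_i `|v i 0|.
Proof.
have s0 : 0 <= \sum_i `|v i 0| by apply: sumr_ge0.
rewrite -(ger0_norm s0) -sqrtr_sqr ler_wsqrtr// expr2 mulr_suml.
apply: ler_sum => i _; rewrite -real_normK ?num_real// expr2 ler_wpM2l//.
by rewrite (bigD1 i)//= lerDl sumr_ge0.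
Qed.

Lemma enormN {n} (v : 'cV[R]_n) : enorm (- v) = enorm v.
Proof. by congr Num.sqrt; apply: eq_bigr => i _; rewrite mxE sqrrN. Qed.

Lemma enorm_eq0 {n} (v : 'cV[R]_n) : enorm v = 0 -> v = 0.
Proof.
move=> v0; apply/matrixP => i j; rewrite ord1 [RHS]mxE; apply/eqP.
by rewrite -normr_le0 -v0 entry_le_enorm.
Qed.

Lemma enorm_mulmx_le {p q} (M : 'M[R]_(p, q)) (v : 'cV[R]_q) :
  enorm (M *m v) <= (\sum_i \sum_j `|M i j|) * enorm v.
Proof.
apply: le_trans (enorm_le_sum _) _; rewrite mulr_suml; apply: ler_sum => i _.
rewrite mxE mulr_suml; apply: le_trans (ler_norm_sum _ _ _) _.
by apply: ler_sum => j _; rewrite normrM ler_wpM2l// entry_le_enorm.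
Qed.

Lemma enorm_delta {n} (j : 'I_n) : enorm (delta_mx j 0 : 'cV[R]_n) = 1.
Proof.
rewrite /enorm (bigD1 j)//= mxE !eqxx expr1n big1 ?addr0 ?sqrtr1// => i ij.
by rewrite mxE (negbTE ij) expr0n.
Qed.

Lemma entry_le_opnorm {p q} (M : 'M[R]_(p, q)) i j : `|M i j| <= opnorm M.
Proof.
have -> : M i j = (M *m (delta_mx j 0 : 'cV[R]_q)) i 0 by rewrite -colE mxE.
apply: le_trans (entry_le_enorm _ _) _; apply: ub_le_sup; last first.
  by exists (delta_mx j 0) => //=; rewrite enorm_delta.
exists (\sum_i \sum_j `|M i j|) => _ [v /= v1 <-].
apply: le_trans (enorm_mulmx_le _ _) _.
by rewrite ler_piMr//; do 2!apply: sumr_ge0 => ? _.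
Qed.

End EuclideanNorm.

(** * Uniformly bounded and Lipschitz families *)

Section BoundedLipschitz.
Context {R : realType} {T : Type} {N : nat}.
Context (D : T -> 'cV[R]_N -> Prop).

(** The first argument is a parameter: the bound and the Lipschitz constant in
    the second argument must not depend on it. Boundedness is part of the notion
    because a product of Lipschitz functions is Lipschitz only when the factors
    are bounded. *)
Definition bounded_lip (f : T -> 'cV[R]_N -> R) : Prop :=
  exists C, forall t u v, D t u -> D t v ->
    `|f t u| <= C /\ `|f t u - f t v| <= C * enorm (u - v).

Lemma bounded_lip_ge0 f : bounded_lip f ->
  exists C, 0 <= C /\ forall t u v, D t u -> D t v ->
    `|f t u| <= C /\ `|f t u - f t v| <= C * enorm (u - v).
Proof.
case=> C hC; exists `|C|; split=> // t u v tu tv.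
have [h1 h2] := hC t u v tu tv; split; first exact: le_trans (ler_norm _).
by apply: le_trans h2 _; rewrite ler_wpM2r ?enorm_ge0 ?ler_norm.
Qed.

Lemma bounded_lip_cst c : bounded_lip (fun _ _ => c).
Proof.
exists `|c| => t u v _ _; split=> //.
by rewrite subrr normr0 mulr_ge0 ?enorm_ge0.
Qed.

Lemma bounded_lipD f g : bounded_lip f -> bounded_lip g ->
  bounded_lip (fun t u => f t u + g t u).
Proof.
move=> [C hC] [E hE]; exists (C + E) => t u v tu tv.
have [f1 f2] := hC t u v tu tv; have [g1 g2] := hE t u v tu tv.
split; first by apply: le_trans (ler_normD _ _) _; exact: lerD.
rewrite opprD addrACA mulrDl.
by apply: le_trans (ler_normD _ _) _; exact: lerD.
Qed.

Lemma bounded_lipM f g : bounded_lip f -> bounded_lip g ->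
  bounded_lip (fun t u => f t u * g t u).
Proof.
move=> /bounded_lip_ge0[C [C0 hC]] /bounded_lip_ge0[E [E0 hE]].
have CE0 : 0 <= C * E by exact: mulr_ge0.
exists (C * E + C * E) => t u v tu tv.
have [f1 f2] := hC t u v tu tv; have [g1 g2] := hE t u v tu tv.
have [g1' _] := hE t v v tv tv.
split; first by rewrite normrM; apply: ler_wpDr => //; exact: ler_pM.
have -> : f t u * g t u - f t v * g t v
        = f t u * (g t u - g t v) + (f t u - f t v) * g t v by ring.
apply: le_trans (ler_normD _ _) _; rewrite !normrM [leRHS]mulrDl; apply: lerD.
  by rewrite -mulrA; exact: ler_pM.
by rewrite mulrAC; exact: ler_pM.
Qed.

Lemma bounded_lip_sum (I : finType) (f : I -> T -> 'cV[R]_N -> R) :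
  (forall i, bounded_lip (f i)) -> bounded_lip (fun t u => \sum_i f i t u).
Proof.
move=> hf; rewrite /bounded_lip.
elim: (index_enum I) => [|i s [E hE]].
  exists 0 => t u v _ _; rewrite !big_nil subrr normr0 mul0r //.
have [C hC] := bounded_lipD _ _ (hf i) (ex_intro _ E hE).
by exists C => t u v tu tv; rewrite !big_cons; exact: hC.
Qed.

(** Entrywise, so that sums and products of matrices reduce to sums and products
    of scalar functions, whatever the matrix norm. *)
Definition bounded_lip_mx {p q} (F : T -> 'cV[R]_N -> 'M[R]_(p, q)) : Prop :=
  forall i j, bounded_lip (fun t u => F t u i j).

Lemma eq_bounded_lip f g : f =2 g -> bounded_lip f -> bounded_lip g.
Proof. by move=> fg [C hC]; exists C => t u v; rewrite -!fg; apply: hC. Qed.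

Lemma bounded_lip_mx_cst {p q} (M : 'M[R]_(p, q)) :
  bounded_lip_mx (fun _ _ => M).
Proof. by move=> i j; exact: bounded_lip_cst. Qed.

Lemma bounded_lip_mxD {p q} (F G : T -> 'cV[R]_N -> 'M[R]_(p, q)) :
  bounded_lip_mx F -> bounded_lip_mx G ->
  bounded_lip_mx (fun t u => F t u + G t u).
Proof.
move=> hF hG i j; apply: eq_bounded_lip (bounded_lipD _ _ (hF i j) (hG i j)).
by move=> t u; rewrite mxE.
Qed.

Lemma bounded_lip_mulmx {p q r} (F : T -> 'cV[R]_N -> 'M[R]_(p, q))
    (G : T -> 'cV[R]_N -> 'M[R]_(q, r)) :
  bounded_lip_mx F -> bounded_lip_mx G ->
  bounded_lip_mx (fun t u => F t u *m G t u).
Proof.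
move=> hF hG i j.
have := bounded_lip_sum _ _ (fun k => bounded_lipM _ _ (hF i k) (hG k j)).
by apply: eq_bounded_lip => t u; rewrite mxE.
Qed.

Lemma bounded_lip_trmx {p q} (F : T -> 'cV[R]_N -> 'M[R]_(p, q)) :
  bounded_lip_mx F -> bounded_lip_mx (fun t u => (F t u)^T).
Proof.
move=> hF i j; apply: eq_bounded_lip (hF j i) => t u.
by rewrite mxE.
Qed.

(** One constant for the entrywise l1 norm, which dominates the norm of the
    induced linear map. *)
Lemma bounded_lip_mx_le {p q} (F : T -> 'cV[R]_N -> 'M[R]_(p, q)) :
  bounded_lip_mx F ->
  exists C, 0 <= C /\ forall t u v, D t u -> D t v ->
    \sum_i \sum_j `|F t u i j| <= C /\
    \sum_i \sum_j `|(F t u - F t v) i j| <= C * enorm (u - v).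
Proof.
move=> hF; have /choice[c hc] : forall k : 'I_p * 'I_q, exists C, 0 <= C /\
    forall t u v, D t u -> D t v -> `|F t u k.1 k.2| <= C /\
    `|F t u k.1 k.2 - F t v k.1 k.2| <= C * enorm (u - v).
  by move=> k; exact: bounded_lip_ge0.
exists (\sum_i \sum_j c (i, j)); split=> [|t u v tu tv].
  by apply: sumr_ge0 => i _; apply: sumr_ge0 => j _; case: (hc (i, j)).
split.
  apply: ler_sum => i _; apply: ler_sum => j _.
  by case: (hc (i, j)) => _ /(_ t u v tu tv)[].
rewrite mulr_suml; apply: ler_sum => i _; rewrite mulr_suml.
apply: ler_sum => j _; rewrite !mxE.
by case: (hc (i, j)) => _ /(_ t u v tu tv)[].
Qed.

Lemma bounded_lip_mx_enorm {p q} (F : T -> 'cV[R]_N -> 'M[R]_(p, q)) :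
  bounded_lip_mx F ->
  exists C, 0 <= C /\ forall t u v, D t u -> D t v -> forall w : 'cV[R]_q,
    enorm (F t u *m w) <= C * enorm w /\
    enorm (F t u *m w - F t v *m w) <= C * enorm (u - v) * enorm w.
Proof.
move=> /bounded_lip_mx_le[C [C0 hC]]; exists C; split=> // t u v tu tv w.
have [h1 h2] := hC t u v tu tv; rewrite -mulmxBl; split.
  by apply: le_trans (enorm_mulmx_le _ _) _; rewrite ler_wpM2r ?enorm_ge0.
by apply: le_trans (enorm_mulmx_le _ _) _; rewrite ler_wpM2r ?enorm_ge0.
Qed.

Lemma bounded_lip_mx_comp {n m p q} (f : 'cV[R]_n -> 'cV[R]_m -> 'M[R]_(p, q))
    (L b : R) X W : 0 <= L ->
  (forall x y u v,
     opnorm (f x u - f y v) <= L * (enorm (x - y) + enorm (u - v))) ->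
  (forall x u, opnorm (f x u) <= b) ->
  bounded_lip_mx X -> bounded_lip_mx W ->
  bounded_lip_mx (fun t u => f (X t u) (W t u)).
Proof.
move=> L0 f_lip f_bnd /bounded_lip_mx_le[C [C0 hC]] /bounded_lip_mx_le[E [E0 hE]].
have enormB_le k (Y : T -> 'cV[R]_N -> 'cV[R]_k) K t u v :
    \sum_i \sum_j `|(Y t u - Y t v) i j| <= K * enorm (u - v) ->
    enorm (Y t u - Y t v) <= K * enorm (u - v).
  apply: le_trans; apply: le_trans (enorm_le_sum _) _.
  by apply: ler_sum => i _; rewrite big_ord1.
move=> i j; exists (Num.max b (L * (C + E))) => t u v tu tv; split.
  apply: le_trans (entry_le_opnorm _ _ _) _.
  by apply: le_trans (f_bnd _ _) _; rewrite le_max lexx.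
have -> : f (X t u) (W t u) i j - f (X t v) (W t v) i j =
          (f (X t u) (W t u) - f (X t v) (W t v)) i j by rewrite !mxE.
apply: le_trans (entry_le_opnorm _ _ _) _.
apply: le_trans (f_lip _ _ _ _) _.
apply: (@le_trans _ _ (L * (C + E) * enorm (u - v))); last first.
  by rewrite ler_wpM2r ?enorm_ge0// le_max lexx orbT.
rewrite -mulrA ler_wpM2l// mulrDl lerD// enormB_le//.
  by case: (hC t u v tu tv).
by case: (hE t u v tu tv).
Qed.

(** Boundedness comes from the fixed lower bound S, and the Lipschitz property
    from H(u)^-1 - H(v)^-1 = - H(u)^-1 (H(u) - H(v)) H(v)^-1. *)
Lemma bounded_lip_invmx {k} (S : 'M[R]_k) (H : T -> 'cV[R]_N -> 'M[R]_k) :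
  sym_pd S -> (forall t u w, D t u -> bilin S w w <= bilin (H t u) w w) ->
  bounded_lip_mx H -> bounded_lip_mx (fun t u => invmx (H t u)).
Proof.
move=> hS SH /bounded_lip_mx_le[C [C0 hC]].
have uH t u : D t u -> H t u \in unitmx.
  move=> tu; apply: bilin_unitmx => w w0.
  by apply: lt_le_trans (SH t u w tu); case: hS => _; apply.
pose b i j := Num.sqrt (invmx S i i * invmx S j j).
have inv_le t u i j : D t u -> `|invmx (H t u) i j| <= b i j.
  move=> tu; rewrite -sqrtr_sqr ler_wsqrtr//.
  by apply: invmx_entry_sq_le => // w; exact: SH.
move=> i j; pose c := \sum_q (\sum_p b i p * C) * b q j.
exists (Num.max (b i j) c) => t u v tu tv; split.
  by apply: le_trans (inv_le _ _ _ _ tu) _; rewrite le_max lexx.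
apply: (@le_trans _ _ (c * enorm (u - v))); last first.
  by rewrite ler_wpM2r ?enorm_ge0// le_max lexx orbT.
have -> : invmx (H t u) i j - invmx (H t v) i j =
    - (invmx (H t u) *m (H t u - H t v) *m invmx (H t v)) i j.
  rewrite mulmxBr mulVmx ?uH// mulmxBl mul1mx -mulmxA mulmxV ?uH// mulmx1.
  by rewrite !mxE opprB.
have [_ hle] := hC t u v tu tv.
have entry_le p q : `|(H t u - H t v) p q| <= C * enorm (u - v).
  apply: le_trans hle; rewrite (bigD1 p)//= (bigD1 q)//= -addrA lerDl.
  by rewrite addr_ge0//; do ?[apply: sumr_ge0 => ? _].
have b0 p q : 0 <= b p q by exact: sqrtr_ge0.
rewrite normrN mxE /c mulr_suml; apply: le_trans (ler_norm_sum _ _ _) _.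
apply: ler_sum => q _; rewrite normrM mulrAC; apply: ler_pM => //; last first.
  exact: inv_le.
rewrite mxE mulr_suml; apply: le_trans (ler_norm_sum _ _ _) _.
apply: ler_sum => p _; rewrite normrM -mulrA; apply: ler_pM => //.
exact: inv_le.
Qed.

End BoundedLipschitz.

(** * Estimates for the iteration map *)

Section IterationMap.
Context {R : realType} {n m ell : nat}.
Context (A : 'cV[R]_n -> 'cV[R]_m -> 'M[R]_n).
Context (B : 'cV[R]_n -> 'cV[R]_m -> 'M[R]_(n, m)).
Context (Q : 'M[R]_n) (Rw : 'M[R]_m) (P : 'M[R]_n).
Context (hQ : sym_psd Q) (hRw : sym_pd Rw) (hP : sym_pd P).
Context (LA LB abar bbar : R) (LA0 : 0 <= LA) (LB0 : 0 <= LB).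
Context (A_lip : forall x y u v,
  opnorm (A x u - A y v) <= LA * (enorm (x - y) + enorm (u - v))).
Context (B_lip : forall x y u v,
  opnorm (B x u - B y v) <= LB * (enorm (x - y) + enorm (u - v))).
Context (A_bnd : forall x u, opnorm (A x u) <= abar).
Context (B_bnd : forall x u, opnorm (B x u) <= bbar).
Context (delta : R).

(** Both balls have the radius [delta]: since c0 >= 1, the anchor satisfies
    |xi| <= delta / c0 <= delta. *)
Definition in_balls (xi : 'cV[R]_n) (U : ctrl_seq R m ell) : Prop :=
  enorm xi <= delta /\ enorm U <= delta.

Notation bl := (bounded_lip_mx in_balls).

Lemma bounded_lip_xi : bl (fun xi _ => xi).
Proof.
move=> i j; exists `|delta| => xi U V [xd _] _; split.
  by rewrite ord1 (le_trans (entry_le_enorm _ _))// (le_trans xd)// ler_norm.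
by rewrite subrr normr0 mulr_ge0 ?enorm_ge0.
Qed.

Lemma bounded_lip_ctrl_block j : bl (fun _ U => ctrl_block U j).
Proof.
rewrite /ctrl_block; case: insubP => [s _ _|_] /=; last exact: bounded_lip_mx_cst.
move=> i l; exists (Num.max 1 delta) => xi U V [_ Ud] _; rewrite !mxE.
rewrite !(ord1 l); set r := (X in U X _); split.
  by rewrite le_max (le_trans (entry_le_enorm _ _) Ud) orbT.
apply: (@le_trans _ _ (1 * enorm (U - V))); last first.
  by rewrite ler_wpM2r ?enorm_ge0// le_max lexx.
by rewrite mul1r; have := entry_le_enorm (U - V) r; rewrite !mxE.
Qed.

(** Each step of the rollout combines the previous state, the control block and
    the coefficients at that pair by sums and products. *)
Lemma bounded_lip_rollout j : bl (fun xi U => rollout A B xi U j).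
Proof.
elim: j => [|j IH] /=; first exact: bounded_lip_xi.
have hu := bounded_lip_ctrl_block j.
by apply: bounded_lip_mxD; apply: bounded_lip_mulmx => //;
  [exact: (bounded_lip_mx_comp _ _ _ _ _ _ LA0 A_lip A_bnd)
  |exact: (bounded_lip_mx_comp _ _ _ _ _ _ LB0 B_lip B_bnd)].
Qed.

Lemma bounded_lip_frozenA j : bl (fun xi U => frozenA A B xi U j).
Proof.
apply: (bounded_lip_mx_comp _ _ _ _ _ _ LA0 A_lip A_bnd).
  exact: bounded_lip_rollout.
exact: bounded_lip_ctrl_block.
Qed.

Lemma bounded_lip_frozenB j : bl (fun xi U => frozenB A B xi U j).
Proof.
apply: (bounded_lip_mx_comp _ _ _ _ _ _ LB0 B_lip B_bnd).
  exact: bounded_lip_rollout.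
exact: bounded_lip_ctrl_block.
Qed.

Lemma bounded_lip_transition c d : bl (fun xi U => transition A B xi U c d).
Proof.
elim: d => [|d IH] /=; first exact: bounded_lip_mx_cst.
by apply: bounded_lip_mulmx => //; exact: bounded_lip_frozenA.
Qed.

Lemma bounded_lip_Phi : bl (fun xi U => bigPhi A B xi U).
Proof.
move=> i j; apply: eq_bounded_lip (bounded_lip_transition 0 (tagnat.sig1 i) (tagnat.sig2 i) j).
by move=> xi U; rewrite mxE.
Qed.

Lemma bounded_lip_Gamma : bl (fun xi U => bigGamma A B xi U).
Proof.
move=> i j; set r := tagnat.sig1 i; set c := tagnat.sig1 j.
have h : bl (fun xi U => if (c < r)%N
    then transition A B xi U c.+1 (r - c.+1) *m frozenB A B xi U c else 0).
  case: (c < r)%N; last exact: bounded_lip_mx_cst.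
  apply: bounded_lip_mulmx; first exact: bounded_lip_transition.
  exact: bounded_lip_frozenB.
by apply: eq_bounded_lip (h (tagnat.sig2 i) (tagnat.sig2 j)) => xi U; rewrite mxE.
Qed.

Lemma sym_psd_bigQ : sym_psd (bigQ Q P ell).
Proof.
by apply: sym_psd_mxdiag => r; case: ifP => _ //; exact: sym_pd_psd.
Qed.

Lemma sym_pd_bigR : sym_pd (bigR Rw ell).
Proof. exact: sym_pd_mxdiag. Qed.

Lemma bigR_le_bigH xi (U : ctrl_seq R m ell) w :
  bilin (bigR Rw ell) w w <= bilin (bigH A B Q Rw P xi U) w w.
Proof.
by rewrite bilin_addmx bilin_congr lerDl; case: sym_psd_bigQ => _; apply.
Qed.

(** The Hessian stays above the block diagonal control weight, which is fixed and
    positive definite, so that its inverse is uniformly bounded. *)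
Lemma bounded_lip_gain :
  bl (fun xi U => invmx (bigH A B Q Rw P xi U) *m (bigGamma A B xi U)^T
                  *m bigQ Q P ell *m bigPhi A B xi U).
Proof.
have hG := bounded_lip_Gamma; have hGT := bounded_lip_trmx _ _ hG.
have hbQ := bounded_lip_mx_cst in_balls (bigQ Q P ell).
apply: bounded_lip_mulmx; last exact: bounded_lip_Phi.
apply: bounded_lip_mulmx; last exact: hbQ.
apply: bounded_lip_mulmx; last exact: hGT.
apply: (bounded_lip_invmx _ _ _ sym_pd_bigR) => [xi U w _|].
  exact: bigR_le_bigH.
apply: bounded_lip_mxD; first exact: bounded_lip_mx_cst.
apply: bounded_lip_mulmx; last exact: hG.
by apply: bounded_lip_mulmx; [exact: hGT|exact: hbQ].
Qed.

(** The iteration map is a gain, bounded and Lipschitz in U, applied to xi: this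
    is where the factor |xi| in both estimates comes from, and with it the
    smallness of the contraction factor for a small anchor. *)
Lemma iter_map_bounds : exists C, 0 <= C /\
  forall xi (U V : ctrl_seq R m ell), in_balls xi U -> in_balls xi V ->
    enorm (iter_map A B Q Rw P xi U) <= C * enorm xi /\
    enorm (iter_map A B Q Rw P xi U - iter_map A B Q Rw P xi V)
      <= C * enorm (U - V) * enorm xi.
Proof.
have [C [C0 hC]] := bounded_lip_mx_enorm _ _ bounded_lip_gain.
exists C; split=> // xi U V hU hV.
by rewrite /iter_map -opprD !enormN; exact: hC.
Qed.

End IterationMap.

(** * Contraction and termination *)

(** The self-map property keeps all iterates in the ball, which is where the
    contraction estimate may be applied at each step. *)
Lemma run_increments {R : realType} {N : nat} (Phi : 'cV[R]_N -> 'cV[R]_N)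
    (delta gamma : R) (Us : nat -> 'cV[R]_N) : 0 <= gamma ->
  (forall U, enorm U <= delta -> enorm (Phi U) <= delta) ->
  (forall U V, enorm U <= delta -> enorm V <= delta ->
     enorm (Phi U - Phi V) <= gamma * enorm (U - V)) ->
  (forall i, (2 <= i)%N -> Us i = Phi (Us i.-1)) ->
  enorm (Us 1%N) <= delta ->
  forall i, enorm (Us i.+2 - Us i.+1) <= gamma ^+ i * enorm (Us 2%N - Us 1%N).
Proof.
move=> g0 self contr step U1.
have ball i : enorm (Us i.+1) <= delta.
  by elim: i => [//|i IH]; rewrite step//; exact: self.
elim=> [|i IH]; first by rewrite expr0 mul1r.
rewrite (step i.+3)// [in X in _ - X](step i.+2)//= exprS -mulrA.
apply: le_trans (contr _ _ (ball _) (ball _)) _.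
by rewrite ler_wpM2l.
Qed.

Section Stopping.
Context {R : realType}.

Lemma bigminn_le {rho a b} (P : pred nat) i : (a <= i < b)%N -> P i ->
  (\big[minn/rho]_(a <= j < b | P j) j <= i)%N.
Proof.
move=> iab Pi; rewrite -minEnat -leEnat.
by apply: (@bigmin_inf_seq _ _ _ _ _ i _ _ _ _ Pi) => //; rewrite mem_index_iota.
Qed.

(** Since ln gamma < 0, the condition gamma^N d < eps reads
    ln (eps / d) / ln gamma < N. *)
Lemma expr_lt_of_log (gamma eps d : R) (N : nat) :
  0 < gamma < 1 -> 0 < eps -> 0 < d ->
  Num.floor (ln (eps / d) / ln gamma) < N%:Z ->
  gamma ^+ N * d < eps.
Proof.
move=> /andP[g0 g1] eps0 d0 hN.
have lng : ln gamma < 0 by rewrite ln_lt0// g0.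
rewrite -ltr_pdivlMr// -ltr_ln ?posrE ?exprn_gt0 ?divr_gt0// lnXn//.
rewrite -mulr_natl -ltr_ndivrMr//.
by apply: lt_le_trans (floorD1_gt _) _; rewrite -[N%:R]/(N%:Z%:~R) ler_int lezD1.
Qed.

(** The tolerance is met at the iterate 2 + N as soon as gamma^N d < eps, where
    d is the norm of the first increment, and N is chosen as the least natural
    number above the ratio of logarithms, as given by its floor. If 2 + N exceeds
    rho, then the cap rho is the smaller bound. *)
Lemma term_iter_le {m ell : nat} (gamma eps : R) (rho : nat)
    (Us : nat -> ctrl_seq R m ell) :
  0 < gamma < 1 -> 0 < eps -> Us 2%N != Us 1%N ->
  (forall i, enorm (Us i.+2 - Us i.+1) <=
             gamma ^+ i * enorm (Us 2%N - Us 1%N)) ->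
  (term_iter rho eps Us)%:Z <=
    Num.min rho%:Z
      (2 + Num.max 0
             (Num.floor (ln (eps / enorm (Us 2%N - Us 1%N)) / ln gamma) + 1)).
Proof.
move=> g01 eps0 U21 hU; set d := enorm _ in hU *.
have d0 : 0 < d.
  rewrite lt_def enorm_ge0 andbT; apply: contra U21 => /eqP/enorm_eq0/eqP.
  by rewrite subr_eq0.
set z := Num.floor _.
have [N hN] : exists N : nat, Num.max 0 (z + 1) = N%:Z.
  by exists `|(Num.max 0 (z + 1))%R|%N; rewrite gez0_abs// le_max lexx.
have zN : z < N%:Z by rewrite -hN lt_max -[z < z + 1]ltrBlDl subrr ltr01 orbT.
have tr : (term_iter rho eps Us <= rho)%N by exact: geq_minl.
rewrite hN le_min lez_nat tr/= -[2 + N%:Z]/((2 + N)%N%:Z) lez_nat.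
have [rN|Nr] := ltnP rho (2 + N); first by apply: leq_trans tr (ltnW rN).
apply: leq_trans (geq_minr _ _) _; apply: bigminn_le; first by rewrite leq_addr.
by apply: le_lt_trans (hU N) _; apply: expr_lt_of_log.
Qed.

End Stopping.

Theorem proposition3 (R : realType) (n m ell : nat) (hell : (2 <= ell)%N)
    (A : 'cV[R]_n -> 'cV[R]_m -> 'M[R]_n)
    (B : 'cV[R]_n -> 'cV[R]_m -> 'M[R]_(n, m))
    (Q : 'M[R]_n) (Rw : 'M[R]_m) (P : 'M[R]_n)
    (hQ : sym_psd Q) (hRw : sym_pd Rw) (hP : sym_pd P)
    (hdare : stabilizing_dare_solution (A 0 0) (B 0 0) Q Rw P)
    (A_C1 : continuously_differentiable
              (fun p : 'cV[R]_n * 'cV[R]_m => A p.1 p.2))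
    (B_C1 : continuously_differentiable
              (fun p : 'cV[R]_n * 'cV[R]_m => B p.1 p.2))
    (LA LB : R) (hLA : 0 < LA) (hLB : 0 < LB)
    (A_lip : forall (x y : 'cV[R]_n) (u v : 'cV[R]_m),
       opnorm (A x u - A y v) <= LA * (enorm (x - y) + enorm (u - v)))
    (B_lip : forall (x y : 'cV[R]_n) (u v : 'cV[R]_m),
       opnorm (B x u - B y v) <= LB * (enorm (x - y) + enorm (u - v)))
    (abar bbar : R) (habar : 0 < abar) (hbbar : 0 < bbar)
    (A_bnd : (ereal_sup (range (fun p : 'cV[R]_n * 'cV[R]_m =>
                (opnorm (A p.1 p.2))%:E)) <= abar%:E)%E)
    (B_bnd : (ereal_sup (range (fun p : 'cV[R]_n * 'cV[R]_m =>
                (opnorm (B p.1 p.2))%:E)) <= bbar%:E)%E)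
    (deltaU : R) (hdeltaU : 0 < deltaU) :
  exists c0 cM : R, [/\ 1 <= c0, 0 < cM &
    forall (gamma : R), 0 < gamma < 1 ->
    forall (rho : nat) (eps : R), (1 <= rho)%N -> 0 < eps ->
    forall (x : nat -> 'cV[R]_n) (u : nat -> 'cV[R]_m)
           (U : nat -> nat -> ctrl_seq R m ell),
    iSCD_MPC_run A B Q Rw P rho eps x u U ->
    forall k : nat,
    enorm (dyn A B (x k) (u k)) <= Num.min (deltaU / c0) (gamma / cM) ->
    enorm (U k 1%N) <= deltaU ->
    U k 2%N != U k 1%N ->
    (term_iter rho eps (U k))%:Z <=
      Num.min rho%:Z
        (2 + Num.max 0
               (Num.floor (ln (eps / enorm (U k 2%N - U k 1%N)) / ln gamma)
                + 1))].
Proof.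
have A_le y v : opnorm (A y v) <= abar.
  rewrite -lee_fin; apply: le_trans A_bnd; apply: ereal_sup_ubound.
  by exists (y, v).
have B_le y v : opnorm (B y v) <= bbar.
  rewrite -lee_fin; apply: le_trans B_bnd; apply: ereal_sup_ubound.
  by exists (y, v).
have [C [C0 hC]] := @iter_map_bounds R n m ell A B Q Rw P hQ hRw hP LA LB
  abar bbar (ltW hLA) (ltW hLB) A_lip B_lip A_le B_le deltaU.
have c_ge1 : 1 <= 1 + C by rewrite lerDl.
have c_gt0 : 0 < 1 + C by exact: lt_le_trans c_ge1.
exists (1 + C), (1 + C); split=> // gamma g01 rho eps _ eps0 x u U.
case=> _ step _ k hxi U1 U21.
have /andP[g0 _] := g01.
set xi := dyn A B (x k) (u k) in hxi.
move: hxi; rewrite le_min !ler_pdivlMr// => /andP[xi_delta xi_gamma].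
have xi0 : 0 <= enorm xi by exact: enorm_ge0.
have C_le : C * enorm xi <= enorm xi * (1 + C).
  by rewrite mulrC ler_wpM2l// lerDr.
have xi_ball : enorm xi <= deltaU.
  by apply: le_trans xi_delta; rewrite ler_peMr.
apply: term_iter_le => //.
apply: (run_increments (iter_map A B Q Rw P xi) deltaU) => //.
- exact: ltW.
- move=> V hV; have [h _] := hC xi V V (conj xi_ball hV) (conj xi_ball hV).
  exact: le_trans h (le_trans C_le xi_delta).
- move=> V W hV hW; have [_ h] := hC xi V W (conj xi_ball hV) (conj xi_ball hW).
  apply: le_trans h _; rewrite mulrAC ler_wpM2r ?enorm_ge0//.
  exact: le_trans C_le xi_gamma.
- by move=> i hi; exact: step.
Qed.
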